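(* Let $\mathcal A,\mathcal B$ be $^*$-algebras over $\mathsf C$. Then any $(\mathcal B$-$\mathcal A)$-bimodule $\mathfrak X$ with an $\mathcal A$-valued inner product satisfying X1--X5 and P yields a functor $\mathfrak R_{\mathfrak X}:{}^*\text{-}\mathsf{rep}(\mathcal A)\to{}^*\text{-}\mathsf{rep}(\mathcal B)$ (algebraic Rieffel induction), given on objects by $(\mathfrak H,\pi_{\mathcal A})\mapsto(\mathfrak K,\pi_{\mathcal B})$, where $\mathfrak K=\widetilde{\mathfrak K}/\widetilde{\mathfrak K}^\perp$, $\widetilde{\mathfrak K}=\mathfrak X\otimes_{\mathcal A}\mathfrak H$ and $\pi_{\mathcal B}(B)[x\otimes\psi]=[B\cdot x\otimes\psi]$, and on morphisms $U:\mathfrak H_1\to\mathfrak H_2$ by $(\mathfrak R_{\mathfrak X}U)[x\otimes\psi]=[x\otimes U\psi]$.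
   Context: An ordered ring is a commutative ring $\mathsf R$ with $1\neq0$ and a subset $\mathsf P$ such that $\mathsf R$ is the disjoint union $-\mathsf P\cup\{0\}\cup\mathsf P$ and $\mathsf P$ is closed under sums and products. Fix such $\mathsf R$ and $\mathsf C=\mathsf R(\mathrm i)=\mathsf R\oplus\mathrm i\mathsf R$, $\mathrm i^2=-1$, with the usual conjugation. A $^*$-algebra over $\mathsf C$ is an associative (not necessarily unital) $\mathsf C$-algebra with an antilinear involution $^*$, $(AB)^*=B^*A^*$. A linear functional $\omega:\mathcal A\to\mathsf C$ is positive if $\omega(A^*A)\ge0$ for all $A$; a Hermitian $A$ is positive ($A\ge0$) if $\omega(A)\ge0$ for all positive linear functionals $\omega$ of $\mathcal A$. A pre-Hilbert space over $\mathsf C$ is a $\mathsf C$-module with a $\mathsf C$-valued inner product, linear in the second argument, Hermitian, with $\langle\phi,\phi\rangle\ge0$ and $\langle\phi,\phi\rangle=0\Rightarrow\phi=0$ (positive semi-definite if the last condition is dropped). $\mathfrak B(\mathfrak H)$ denotes the adjointable $\mathsf C$-linear endomorphisms. ${}^*\text{-}\mathsf{rep}(\mathcal A)$ is the category whose objects are $^*$-representations of $\mathcal A$, i.e. $^*$-homomorphisms $\pi:\mathcal A\to\mathfrak B(\mathfrak H)$ with $\mathfrak H$ a pre-Hilbert space over $\mathsf C$, and whose morphisms are isometric (alternatively: adjointable, or unitary) intertwiners; the same choice of morphisms is made for $\mathcal A$ and $\mathcal B$. A $(\mathcal B$-$\mathcal A)$-bimodule is a $\mathsf C$-module $\mathfrak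 X$ with commuting $\mathsf C$-linear left $\mathcal B$-action and right $\mathcal A$-action. For a map $\langle\cdot,\cdot\rangle_{\mathcal A}:\mathfrak X\times\mathfrak X\to\mathcal A$ the axioms are, for all $x,y,z\in\mathfrak X$, $a,b\in\mathsf C$, $A\in\mathcal A$, $B\in\mathcal B$: X1) $\langle x,ay+bz\rangle_{\mathcal A}=a\langle x,y\rangle_{\mathcal A}+b\langle x,z\rangle_{\mathcal A}$; X2) $\langle x,y\rangle_{\mathcal A}=\langle y,x\rangle_{\mathcal A}^*$; X3) $\langle x,y\cdot A\rangle_{\mathcal A}=\langle x,y\rangle_{\mathcal A}A$; X4) $\langle x,x\rangle_{\mathcal A}\ge0$; X5) $\langle x,B\cdot y\rangle_{\mathcal A}=\langle B^*\cdot x,y\rangle_{\mathcal A}$. For a $^*$-representation $(\mathfrak H,\pi_{\mathcal A})$ of $\mathcal A$, $\widetilde{\mathfrak K}=\mathfrak X\otimes_{\mathcal A}\mathfrak H$ is the quotient of $\mathfrak X\otimes_{\mathsf C}\mathfrak H$ by the span of all $x\cdot A\otimes\psi-x\otimes\pi_{\mathcal A}(A)\psi$, with the sesquilinear form determined by $\langle x\otimes\psi,y\otimes\phi\rangle_{\widetilde{\mathfrak K}}=\langle\psi,\pi_{\mathcal A}(\langle x,y\rangle_{\mathcal A})\phi\rangle_{\mathfrak H}$; $\widetilde{\mathfrak K}^\perp$ is the set of vectors orthogonal to all of $\widetilde{\mathfrak K}$. Axiom P): this form is positive semi-definite for every $^*$-representation $(\mathfrak H,\pi_{\mathcal A})$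 of $\mathcal A$. $\mathfrak K$ carries the induced inner product. *)

(* Defs.v *)
From HB Require Import structures.
From mathcomp Require Import all_boot all_order all_algebra.
From mathcomp.classical Require Import boolp classical_sets functions.
From mathcomp.real_closed Require Import complex.
From mathcomp.multinomials Require Import freeg.

Set Implicit Arguments.
Unset Strict Implicit.
Unset Printing Implicit Defensive.

Import GRing.Theory.

Local Open Scope ring_scope.
Local Open Scope quotient_scope.

HB.mixin Record isOrderedRing R of GRing.ComNzRing R := {
  rpos : R -> Prop;
  rpos_total : forall x : R, [\/ rpos (- x), x = 0 | rpos x];
  rpos0 : ~ rpos 0;
  rpos_anti : forall x : R, rpos x -> ~ rpos (- x);
  rposD : forall x y : R, rpos x -> rpos y -> rpos (x + y);
  rposM : forall x y : R, rpos x -> rpos y -> rpos (x * y)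
}.

#[short(type="orderedRingType")]
HB.structure Definition OrderedRing := {R of GRing.ComNzRing R & isOrderedRing R}.

(* [R[i]] only has a ring structure in the library when R is a field, hence
   the alias; the product is the library's [ComplexField.mulc]. *)
Definition cplx (R : comNzRingType) : Type := R[i].

HB.instance Definition _ (R : comNzRingType) :=
  GRing.Zmodule.copy (cplx R) R[i].

Section CplxRing.
Variable R : comNzRingType.

Fact cplx_mul1 :
  left_id (Complex 1 0 : cplx R) (@ComplexField.mulc R : _ -> _ -> cplx R).
Proof. by move=> [a b] /=; rewrite !mul1r !mul0r subr0 addr0. Qed.

Fact cplx_mulDl : left_distributive (@ComplexField.mulc R : _ -> _ -> cplx R) +%R.
Proof.
move=> [a b] [c d] [e f]; rewrite [LHS]/=.
rewrite [RHS]/GRing.add /= !mulrDl !opprD.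
by congr Complex; rewrite addrACA.
Qed.

Fact cplx_1neq0 : (Complex 1 0 : cplx R) != 0.
Proof. by apply/eqP => -[/eqP]; rewrite oner_eq0. Qed.

HB.instance Definition _ := GRing.Zmodule_isComNzRing.Build (cplx R)
  (@ComplexField.mulcA R) (@ComplexField.mulcC R) cplx_mul1 cplx_mulDl cplx_1neq0.

Definition cconj (z : cplx R) : cplx R := conjc z.

Lemma cconjD : {morph cconj : x y / x + y}.
Proof. by move=> [a b] [c d]; congr Complex; rewrite /= opprD. Qed.

Lemma cconjM : {morph cconj : x y / x * y}.
Proof.
by move=> [a b] [c d]; congr Complex; rewrite /= ?mulrNN // opprD mulrN mulNr.
Qed.

Lemma cconjK : involutive cconj.
Proof. by move=> [a b]; rewrite /cconj /= opprK. Qed.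

Lemma cconjN : {morph cconj : x / - x}.
Proof. by move=> [a b]. Qed.

Lemma cconj0 : cconj 0 = 0.
Proof. by congr Complex; rewrite oppr0. Qed.

Lemma cconj1 : cconj 1 = 1.
Proof. by congr Complex; rewrite oppr0. Qed.

End CplxRing.

(* [0 <= z] for [z] in [C = R(i)], where [R] is regarded as a subset of [C]. *)
Definition cge0 (R : orderedRingType) (z : cplx R) : Prop :=
  Im z = 0 /\ (Re z = 0 \/ rpos (Re z)).

(* Algebras need not be unital, so that the library's algebra structures
   do not apply. *)
HB.mixin Record isStarAlgebra (R : orderedRingType) A
    of GRing.Lmodule (cplx R) A := {
  amul : A -> A -> A;
  astar : A -> A;
  amulA : associative amul;
  amul_linl : forall b : A, linear (amul^~ b);
  amul_linr : forall a : A, linear (amul a);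
  astarD : {morph astar : a b / a + b};
  astarZ : forall (c : cplx R) (a : A), astar (c *: a) = cconj c *: astar a;
  astarM : forall a b : A, astar (amul a b) = amul (astar b) (astar a);
  astarK : involutive astar
}.

#[short(type="starAlgType")]
HB.structure Definition StarAlgebra (R : orderedRingType) :=
  {A of GRing.Lmodule (cplx R) A & isStarAlgebra R A}.

Definition positive_functional (R : orderedRingType) (A : starAlgType R)
    (w : {scalar A}) : Prop :=
  forall a : A, cge0 (w (amul (astar a) a)).

Definition positive_element (R : orderedRingType) (A : starAlgType R) (a : A) :
    Prop :=
  astar a = a /\
  forall w : {scalar A}, positive_functional w -> cge0 (w a).

Record star_hom (R : orderedRingType) (A B : starAlgType R) := StarHom {
  star_hom_fun :> A -> B;
  star_hom_linear : linear star_hom_fun;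
  star_homM : {morph star_hom_fun : a b / amul a b};
  star_hom_star : {morph star_hom_fun : a / astar a}
}.

(* Modules with a Hermitian form, linear in the second argument and with no
   positivity requirement. *)
HB.mixin Record isHermSpace (R : orderedRingType) V
    of GRing.Lmodule (cplx R) V := {
  ip : V -> V -> cplx R;
  ip_linr : forall u : V, scalar (ip u);
  ip_conj : forall u v : V, ip u v = cconj (ip v u)
}.

#[short(type="hermSpaceType")]
HB.structure Definition HermSpace (R : orderedRingType) :=
  {V of GRing.Lmodule (cplx R) V & isHermSpace R V}.

Definition pos_semidef (R : orderedRingType) (V : hermSpaceType R) : Prop :=
  forall u : V, cge0 (ip u u).

Definition is_preHilbert (R : orderedRingType) (V : hermSpaceType R) : Prop :=
  pos_semidef V /\ forall u : V, ip u u = 0 -> u = 0.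

Record preHilbert (R : orderedRingType) := PreHilbert {
  ph_space :> hermSpaceType R;
  phP : is_preHilbert ph_space
}.

Section HermTheory.
Variables (R : orderedRingType) (V : hermSpaceType R).
Implicit Types (u v w : V) (c : cplx R).

Lemma ipDr u v w : ip u (v + w) = ip u v + ip u w.
Proof. by have := ip_linr u 1 v w; rewrite scale1r mul1r. Qed.

Lemma ip0r u : ip u 0 = 0.
Proof. by apply: (addrI (ip u 0)); rewrite -ipDr !addr0. Qed.

Lemma ipZr u c v : ip u (c *: v) = c * ip u v.
Proof. by have := ip_linr u c v 0; rewrite ip0r !addr0. Qed.

Lemma ipNr u v : ip u (- v) = - ip u v.
Proof. by rewrite -scaleN1r ipZr mulN1r. Qed.

Lemma ipDl u v w : ip (u + v) w = ip u w + ip v w.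
Proof. by rewrite ip_conj ipDr cconjD -!ip_conj. Qed.

Lemma ip0l u : ip 0 u = 0.
Proof. by rewrite ip_conj ip0r cconj0. Qed.

Lemma ipZl u c v : ip (c *: u) v = cconj c * ip u v.
Proof. by rewrite ip_conj ipZr cconjM -ip_conj. Qed.

Lemma ipNl u v : ip (- u) v = - ip u v.
Proof. by rewrite ip_conj ipNr cconjN -ip_conj. Qed.

End HermTheory.

Definition is_adjoint (R : orderedRingType) (V W : hermSpaceType R)
    (T : V -> W) (S : W -> V) : Prop :=
  forall (w : W) (v : V), ip w (T v) = ip (S w) v.

(* The *-algebra [adjop H] of adjointable endomorphisms of [H]. *)
Section Adjointable.
Variables (R : orderedRingType) (H : preHilbert R).

Definition adjointable : {pred H -> H} :=
  [pred T | `[< linear T /\ exists S : H -> H, is_adjoint T S >]].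

Lemma adjointableP (T : H -> H) :
  reflect (linear T /\ exists S : H -> H, is_adjoint T S) (T \in adjointable).
Proof. exact: asboolP. Qed.

Record adjop := AdjOp { adjop_fun :> H -> H; _ : adjop_fun \in adjointable }.

HB.instance Definition _ := [isSub for adjop_fun].
HB.instance Definition _ := [Choice of adjop by <:].

Fact adjointable_submod : submod_closed adjointable.
Proof.
split=> [|c S T /adjointableP[linS [S' adjS]] /adjointableP[linT [T' adjT]]].
  apply/adjointableP; split; first by move=> a u v; rewrite scaler0 addr0.
  by exists (fun=> 0) => w v; rewrite ip0r ip0l.
apply/adjointableP; split.
  move=> a u v; change (c *: S (a *: u + v) + T (a *: u + v) =
    a *: (c *: S u + T u) + (c *: S v + T v)).
  by rewrite linS linT !scalerDr !scalerA [c * a]mulrC addrACA.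
exists (fun w => cconj c *: S' w + T' w) => w v.
by rewrite ipDl ipZl cconjK -adjS -adjT -ipZr -ipDr.
Qed.

HB.instance Definition _ := GRing.isSubmodClosed.Build _ _ adjointable
  adjointable_submod.
HB.instance Definition _ := [SubChoice_isSubLmodule of adjop by <:].

Lemma adjop_linear (T : adjop) : linear T.
Proof. by case: T => T /= /adjointableP[]. Qed.

Fact adjop_mul_subproof (S T : adjop) : (S : H -> H) \o T \in adjointable.
Proof.
case: S T => [S /= /adjointableP[linS [S' adjS]]].
case=> [T /= /adjointableP[linT [T' adjT]]].
apply/adjointableP; split; first by move=> a u v /=; rewrite linT linS.
by exists (T' \o S') => w v /=; rewrite adjS adjT.
Qed.

Definition adjop_mul (S T : adjop) : adjop := AdjOp (adjop_mul_subproof S T).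

Fact adjop_adj (T : adjop) : {S : H -> H | is_adjoint T S}.
Proof. by apply: cid; case: T => T /= /adjointableP[]. Qed.

Lemma ph_inj (u v : H) : (forall w, ip w u = ip w v) -> u = v.
Proof.
move=> e; apply/eqP; rewrite -subr_eq0; apply/eqP/(phP H).2.
by rewrite ipDr ipNr e subrr.
Qed.

Fact adjop_star_subproof (T : adjop) : sval (adjop_adj T) \in adjointable.
Proof.
case: (adjop_adj T) => S /= adjS; apply/adjointableP.
have adjS' : is_adjoint S T by move=> w v; rewrite ip_conj -adjS -ip_conj.
split; last by exists T.
move=> c u v; apply: ph_inj => w.
by rewrite ipDr ipZr !adjS' ipDr ipZr.
Qed.

Definition adjop_star (T : adjop) : adjop := AdjOp (adjop_star_subproof T).

Lemma adjop_starP (T : adjop) : is_adjoint T (adjop_star T).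
Proof. exact: (svalP (adjop_adj T)). Qed.

Lemma adjop_eqP (S T : adjop) : (S : H -> H) =1 T -> S = T.
Proof. by move=> e; apply/val_inj/funext. Qed.

Lemma adjoint_uniq (T : adjop) (S S' : H -> H) :
  is_adjoint T S -> is_adjoint T S' -> S =1 S'.
Proof.
by move=> h h' u; apply: ph_inj => w; rewrite ip_conj -h h' -ip_conj.
Qed.

Fact adjop_mulA : associative adjop_mul.
Proof. by move=> S T U; apply: adjop_eqP. Qed.

Fact adjop_mul_linl (T : adjop) : linear (adjop_mul^~ T).
Proof. by move=> c S U; apply: adjop_eqP. Qed.

Fact adjop_mul_linr (S : adjop) : linear (adjop_mul S).
Proof. by move=> c T U; apply: adjop_eqP => u; apply: adjop_linear. Qed.

Fact adjop_starD : {morph adjop_star : S T / S + T}.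
Proof.
move=> S T; apply/adjop_eqP/(adjoint_uniq (adjop_starP _)) => w v.
by rewrite ipDr !adjop_starP -ipDl.
Qed.

Fact adjop_starZ (c : cplx R) (T : adjop) :
  adjop_star (c *: T) = cconj c *: adjop_star T.
Proof.
apply/adjop_eqP/(adjoint_uniq (adjop_starP _)) => w v.
by rewrite ipZr !adjop_starP -[c in LHS]cconjK -ipZl.
Qed.

Fact adjop_starM (S T : adjop) :
  adjop_star (adjop_mul S T) = adjop_mul (adjop_star T) (adjop_star S).
Proof.
apply/adjop_eqP/(adjoint_uniq (adjop_starP _)) => w v.
by rewrite /= !adjop_starP.
Qed.

Fact adjop_starK : involutive adjop_star.
Proof.
move=> T; apply/adjop_eqP/(adjoint_uniq (adjop_starP _)) => w v.
by rewrite ip_conj -adjop_starP -ip_conj.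
Qed.

HB.instance Definition _ := isStarAlgebra.Build R adjop
  adjop_mulA adjop_mul_linl adjop_mul_linr
  adjop_starD adjop_starZ adjop_starM adjop_starK.

End Adjointable.

Record starRep (R : orderedRingType) (A : starAlgType R) := StarRep {
  rep_space :> preHilbert R;
  rep_act : star_hom A (adjop rep_space)
}.

Section QuotientModule.
Variables (R : pzRingType) (V : lmodType R) (S : submodClosed V).

(* Same predicate as [S]; the library does not infer closure under opposites
   from [submodClosed], and [Quotient.quot] needs it. *)
Definition submod_pred : {pred V} := S.

Fact submod_pred_zmod : zmod_closed submod_pred.
Proof.
split; first exact: (rpred0 S).
by move=> u v Su Sv; rewrite -scaleN1r rpredD// rpredZ.
Qed.

HB.instance Definition _ := GRing.isZmodClosed.Build V submod_pred
  submod_pred_zmod.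

Definition quotmod : Type := Quotient.quot submod_pred.
HB.instance Definition _ := GRing.Zmodule.on quotmod.

Definition qclass (v : V) : quotmod := \pi v.

Lemma qclass_eq (u v : V) : (qclass u = qclass v) <-> (u - v \in S).
Proof.
rewrite -[u - v \in S]/(u - v \in submod_pred) Quotient.idealrBE.
by split=> [e|/eqP//]; apply/eqP.
Qed.

Definition qrepr (x : quotmod) : V := repr (x : Quotient.quot submod_pred).

Lemma qreprK : cancel qrepr qclass.
Proof. exact: reprK. Qed.

Lemma qclassD : {morph qclass : u v / u + v}.
Proof. exact: raddfD. Qed.

Definition qscale (c : R) (x : quotmod) : quotmod := qclass (c *: qrepr x).

Lemma qscaleE c v : qscale c (qclass v) = qclass (c *: v).
Proof.
by apply/qclass_eq; rewrite -scalerBr rpredZ//; apply/qclass_eq/qreprK.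
Qed.

Fact qscaleA a b x : qscale a (qscale b x) = qscale (a * b) x.
Proof. by rewrite -[x]qreprK !qscaleE scalerA. Qed.

Fact qscale1 : left_id 1 qscale.
Proof. by move=> x; rewrite -[x]qreprK qscaleE scale1r. Qed.

Fact qscaleDr : right_distributive qscale +%R.
Proof.
move=> c x y; rewrite -[x]qreprK -[y]qreprK -qclassD !qscaleE.
by rewrite scalerDr qclassD.
Qed.

Fact qscaleDl x : {morph qscale^~ x : a b / a + b}.
Proof. by move=> a b; rewrite -[x]qreprK !qscaleE scalerDl qclassD. Qed.

HB.instance Definition _ := GRing.Zmodule_isLmodule.Build R quotmod
  qscaleA qscale1 qscaleDr qscaleDl.

Lemma qclass_linear : linear qclass.
Proof. by move=> c u v; rewrite qclassD -qscaleE. Qed.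

End QuotientModule.

Section Span.
Variables (R : pzRingType) (V : lmodType R) (S : V -> Prop).

Inductive lincomb : V -> Prop :=
| lincomb0 : lincomb 0
| lincombS c s v : S s -> lincomb v -> lincomb (c *: s + v).

Definition lspan : {pred V} := [pred v | `[< lincomb v >]].

Lemma lspanP v : reflect (lincomb v) (v \in lspan).
Proof. exact: asboolP. Qed.

Fact lspan_submod : submod_closed lspan.
Proof.
split=> [|c u v /lspanP Su /lspanP Sv]; first exact/lspanP/lincomb0.
apply/lspanP; elim: Su => [|d s w Ss _ IHw]; first by rewrite scaler0 add0r.
by rewrite scalerDr scalerA -addrA; apply: lincombS.
Qed.

HB.instance Definition _ := GRing.isSubmodClosed.Build _ _ lspan lspan_submod.

Lemma mem_lspan s : S s -> s \in lspan.
Proof.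
by move=> Ss; apply/lspanP; rewrite -[s]addr0 -[s]scale1r;
  apply: lincombS lincomb0.
Qed.

End Span.

(* [tensor V W] is the free module on [V * W] modulo the bilinearity relations,
   and [tens v w] is the class of [(v, w)]. *)
Section Tensor.
Variables (R : nzRingType) (V W : lmodType R).

Local Notation "[ v , w ]" := (<< 1 *g (v, w) >> : {freeg (V * W)%type / R}).

Inductive bilinear_rel : {freeg (V * W)%type / R} -> Prop :=
| bilinDl v v' w : bilinear_rel ([v + v', w] - [v, w] - [v', w])
| bilinDr v w w' : bilinear_rel ([v, w + w'] - [v, w] - [v, w'])
| bilinZl c v w : bilinear_rel ([c *: v, w] - c *: [v, w])
| bilinZr c v w : bilinear_rel ([v, c *: w] - c *: [v, w]).

Definition tensor : Type := quotmod (lspan bilinear_rel).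
HB.instance Definition _ := GRing.Lmodule.on tensor.

Definition tens (v : V) (w : W) : tensor := qclass (lspan bilinear_rel) [v, w].

End Tensor.

(* The sesquilinear extension to the free module on [K] of a function on pairs
   of basis elements, antilinear in the first argument. *)
Section FreeForm.
Variables (R : comNzRingType) (K : choiceType) (g : K -> K -> cplx R).
Implicit Types u v w : {freeg K / cplx R}.

Definition freeform u v : cplx R :=
  \sum_(p <- dom u) \sum_(q <- dom v) cconj (coeff p u) * coeff q v * g p q.

Lemma fgsum_widen (f : K -> cplx R) v (s : seq K) :
  uniq s -> {subset dom v <= s} ->
  \sum_(q <- dom v) coeff q v * f q = \sum_(q <- s) coeff q v * f q.
Proof.
move=> us sub; rewrite [RHS](bigID (mem (dom v))) /=.
rewrite [X in _ = _ + X]big1 => [|q /coeff_outdom ->]; last by rewrite mul0r.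
rewrite addr0 -[RHS]big_filter; apply: perm_big; apply: uniq_perm.
- exact: uniq_dom.
- exact: filter_uniq.
by move=> q; rewrite mem_filter; apply/idP/andP => [qv|[]//]; split; auto.
Qed.

Lemma fgsum_linear (f : K -> cplx R) :
  scalar (fun v : {freeg K / cplx R} => \sum_(q <- dom v) coeff q v * f q).
Proof.
move=> c u v; pose s := undup (dom (c *: u + v) ++ dom u ++ dom v).
rewrite !(@fgsum_widen f _ s) ?undup_uniq//;
  try by move=> q; rewrite mem_undup !mem_cat => ->; rewrite ?orbT.
rewrite mulr_sumr -big_split; apply: eq_bigr => q _ /=.
by rewrite coeffD coeffZ mulrDl mulrA.
Qed.

Lemma freeform_linr u : scalar (freeform u).
Proof.
have e v : freeform u v = \sum_(q <- dom v) coeff q v *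
    \sum_(p <- dom u) cconj (coeff p u) * g p q.
  rewrite /freeform exchange_big; apply: eq_bigr => q _ /=.
  by rewrite mulr_sumr; apply: eq_bigr => p _; rewrite mulrCA mulrA.
by move=> c v w; rewrite !e fgsum_linear.
Qed.

Lemma freeformUr u q :
  freeform u << q >> = \sum_(p <- dom u) cconj (coeff p u) * g p q.
Proof.
by apply: eq_bigr => p _; rewrite domU1 big_seq1 coeffU eqxx !mulr1.
Qed.

Lemma freeformU p q : freeform << p >> << q >> = g p q.
Proof.
by rewrite freeformUr domU1 big_seq1 coeffU eqxx mulr1 cconj1 mul1r.
Qed.

Lemma freeform_conj : (forall p q, g p q = cconj (g q p)) ->
  forall u v, freeform u v = cconj (freeform v u).
Proof.
move=> gC u v; rewrite /freeform (big_morph _ (@cconjD R) (cconj0 R)).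
rewrite exchange_big; apply: eq_bigr => p _ /=.
rewrite (big_morph _ (@cconjD R) (cconj0 R)); apply: eq_bigr => q _.
by rewrite !cconjM cconjK -gC [coeff p v * _]mulrC.
Qed.

End FreeForm.

(* [qform f] is defined through representatives; [qformE] shows that it is the
   form induced by [f] when [f] is Hermitian and vanishes on [S]. *)
Section QuotientForm.
Variables (R : orderedRingType) (V : lmodType (cplx R)) (S : submodClosed V).
Variable f : V -> V -> cplx R.

Definition qform (x y : quotmod S) : cplx R := f (qrepr x) (qrepr y).

Hypothesis f_linr : forall u, scalar (f u).
Hypothesis f_conj : forall u v, f u v = cconj (f v u).
Hypothesis f_ker : forall u v, v \in S -> f u v = 0.

Lemma qformE u v : qform (qclass S u) (qclass S v) = f u v.
Proof.
have fr x y z : qclass S y = qclass S z -> f x y = f x z.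
  move=> /qclass_eq Syz; have := f_linr x 1 (y - z) z.
  by rewrite scale1r mul1r subrK (f_ker _ Syz) add0r.
by rewrite /qform (fr _ _ v) ?qreprK// f_conj (fr _ _ u) ?qreprK.
Qed.

Lemma qform_linr x : scalar (qform x).
Proof.
move=> c y z; rewrite -[x]qreprK -[y]qreprK -[z]qreprK -qclass_linear !qformE.
exact: f_linr.
Qed.

Lemma qform_conj x y : qform x y = cconj (qform y x).
Proof. by rewrite -[x]qreprK -[y]qreprK !qformE. Qed.

End QuotientForm.

Section ScalarTheory.
Variables (R : nzRingType) (V : lmodType R) (f : V -> R).
Hypothesis f_lin : scalar f.

Lemma scalarfD u v : f (u + v) = f u + f v.
Proof. by have := f_lin 1 u v; rewrite scale1r mul1r. Qed.

Lemma scalarf0 : f 0 = 0.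
Proof. by apply: (addrI (f 0)); rewrite -scalarfD !addr0. Qed.

Lemma scalarfZ c u : f (c *: u) = c * f u.
Proof. by have := f_lin c u 0; rewrite scalarf0 !addr0. Qed.

Lemma scalarfB u v : f (u - v) = f u - f v.
Proof. by rewrite scalarfD -scaleN1r scalarfZ mulN1r. Qed.

End ScalarTheory.

Lemma lspan_ker (R : orderedRingType) (V : lmodType (cplx R)) (S : V -> Prop)
    (f : V -> cplx R) : scalar f -> (forall s, S s -> f s = 0) ->
  forall v, v \in lspan S -> f v = 0.
Proof.
move=> f_lin fS v /lspanP; elim=> [|c s w Ss _ IHw].
  exact: scalarf0.
by rewrite f_lin fS// mulr0 add0r.
Qed.

(* The quotient of [V] by the radical of its form, with the induced form. *)
Section Reduction.
Variables (R : orderedRingType) (V : hermSpaceType R).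

Definition orth : {pred V} := [pred u | `[< forall v : V, ip v u = 0 >]].

Fact orth_submod : submod_closed orth.
Proof.
split=> [|c u w /asboolP ou /asboolP ow]; apply/asboolP => v.
  exact: ip0r.
by rewrite ipDr ipZr ou ow mulr0 addr0.
Qed.

HB.instance Definition _ := GRing.isSubmodClosed.Build _ _ orth orth_submod.

Definition reduction : Type := quotmod orth.
HB.instance Definition _ := GRing.Lmodule.on reduction.

Fact orth_ker (u v : V) : v \in orth -> ip u v = 0.
Proof. by move=> /asboolP. Qed.

HB.instance Definition _ := isHermSpace.Build R reduction
  (qform_linr (@ip_linr R V) (@ip_conj R V) orth_ker)
  (qform_conj (@ip_linr R V) (@ip_conj R V) orth_ker).

End Reduction.

HB.mixin Record isBimodule (R : orderedRingType) (B A : starAlgType R) X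
    of GRing.Lmodule (cplx R) X := {
  lact : B -> X -> X;
  ract : X -> A -> X;
  lact_linl : forall x : X, linear (lact^~ x);
  lact_linr : forall b : B, linear (lact b);
  lactM : forall (b b' : B) (x : X), lact (amul b b') x = lact b (lact b' x);
  ract_linl : forall a : A, linear (ract^~ a);
  ract_linr : forall x : X, linear (ract x);
  ractM : forall (x : X) (a a' : A), ract x (amul a a') = ract (ract x a) a';
  lractA : forall (b : B) (x : X) (a : A), lact b (ract x a) = ract (lact b x) a
}.

#[short(type="bimodType")]
HB.structure Definition Bimodule (R : orderedRingType) (B A : starAlgType R) :=
  {X of GRing.Lmodule (cplx R) X & isBimodule R B A X}.

HB.mixin Record isInnerBimodule (R : orderedRingType) (B A : starAlgType R) X
    of Bimodule R B A X := {
  aip : X -> X -> A;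
  aip_linr : forall x : X, linear (aip x);
  aip_star : forall x y : X, aip x y = astar (aip y x);
  aip_ract : forall (x y : X) (a : A), aip x (ract y a) = amul (aip x y) a;
  aip_ge0 : forall x : X, positive_element (aip x x);
  aip_lact : forall (x y : X) (b : B),
    aip x (lact b y) = aip (lact (astar b) x) y
}.

#[short(type="innerBimodType")]
HB.structure Definition InnerBimodule (R : orderedRingType)
    (B A : starAlgType R) := {X of Bimodule R B A X & isInnerBimodule R B A X}.

(* [balanced] is the tensor product of [X] and [H] over [A], with the form
   characterized by [ip_btens]; [rieffel_space] is its quotient by the radical. *)
Section RieffelSpace.
Variables (R : orderedRingType) (B A : starAlgType R).
Variables (X : innerBimodType B A) (H : starRep A).

Local Notation pi := (rep_act H).

Inductive balanced_rel : tensor X H -> Prop :=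
| balancedA (x : X) (a : A) (psi : H) :
    balanced_rel (tens (ract x a) psi - tens x (pi a psi)).

Definition balanced : Type := quotmod (lspan balanced_rel).
HB.instance Definition _ := GRing.Lmodule.on balanced.

Definition btens (x : X) (psi : H) : balanced :=
  qclass (lspan balanced_rel) (tens x psi).

Definition gen_form (p q : X * H) : cplx R :=
  ip p.2 (pi (aip p.1 q.1) q.2).

Definition tensor_form : tensor X H -> tensor X H -> cplx R :=
  qform (freeform gen_form).

Definition balanced_form : balanced -> balanced -> cplx R :=
  qform tensor_form.

Fact gen_form_conj p q : gen_form p q = cconj (gen_form q p).
Proof.
rewrite /gen_form [aip p.1 _]aip_star star_hom_star.
by rewrite [in RHS]adjop_starP -ip_conj.
Qed.

Fact gen_form_linx p psi : scalar (fun x : X => gen_form p (x, psi)).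
Proof.
move=> c x y; rewrite /gen_form /= aip_linr star_hom_linear.
by rewrite -ip_linr.
Qed.

Fact gen_form_linpsi p x : scalar (fun psi : H => gen_form p (x, psi)).
Proof. by move=> c u v; rewrite /gen_form /= adjop_linear ip_linr. Qed.

Fact gen_form_ract p x a psi :
  gen_form p (ract x a, psi) = gen_form p (x, pi a psi).
Proof. by rewrite /gen_form /= aip_ract star_homM. Qed.

Fact tensor_form_ker u v : v \in lspan (@bilinear_rel _ X H) ->
  freeform gen_form u v = 0.
Proof.
apply: lspan_ker; first exact: freeform_linr.
have lu := freeform_linr gen_form u.
move=> _ [x y psi|x psi phi|c x psi|c x psi];
  rewrite !(scalarfB lu) ?(scalarfZ lu) !freeformUr ?mulr_sumr -!sumrB;
  apply: big1 => p _.
- by rewrite (scalarfD (gen_form_linx p psi)) mulrDr [X in X - _]addrAC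
    subrr add0r subrr.
- by rewrite (scalarfD (gen_form_linpsi p x)) mulrDr [X in X - _]addrAC
    subrr add0r subrr.
- by rewrite (scalarfZ (gen_form_linx p psi)) mulrCA subrr.
- by rewrite (scalarfZ (gen_form_linpsi p x)) mulrCA subrr.
Qed.

Let free_linr := freeform_linr gen_form.
Let free_conj := freeform_conj gen_form_conj.

Fact tensor_form_linr s : scalar (tensor_form s).
Proof. exact: (qform_linr free_linr free_conj tensor_form_ker). Qed.

Fact tensor_form_conj s t : tensor_form s t = cconj (tensor_form t s).
Proof. exact: (qform_conj free_linr free_conj tensor_form_ker). Qed.

Fact balanced_form_ker s t : t \in lspan balanced_rel -> tensor_form s t = 0.
Proof.
apply: lspan_ker; first exact: tensor_form_linr.
move=> _ [x a psi]; rewrite (scalarfB (tensor_form_linr s)) -[s]qreprK.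
rewrite /tensor_form !(qformE free_linr free_conj tensor_form_ker).
rewrite !freeformUr -sumrB; apply: big1 => p _.
by rewrite gen_form_ract subrr.
Qed.

HB.instance Definition _ := isHermSpace.Build R balanced
  (qform_linr tensor_form_linr tensor_form_conj balanced_form_ker)
  (qform_conj tensor_form_linr tensor_form_conj balanced_form_ker).

Lemma ip_btens (x y : X) (psi phi : H) :
  ip (btens x psi) (btens y phi) = ip psi (pi (aip x y) phi).
Proof.
rewrite [LHS](qformE tensor_form_linr tensor_form_conj balanced_form_ker).
rewrite /tensor_form (qformE free_linr free_conj tensor_form_ker).
exact: freeformU.
Qed.

Definition rieffel_space : hermSpaceType R := reduction balanced.

Definition rclass (x : X) (psi : H) : rieffel_space :=
  qclass (@orth R balanced) (btens x psi).

End RieffelSpace.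

Definition balanced_semidef (R : orderedRingType) (B A : starAlgType R)
    (X : innerBimodType B A) : Prop :=
  forall H : starRep A, pos_semidef (balanced X H).

Record category := Category {
  cat_ob :> Type;
  cat_hom : cat_ob -> cat_ob -> Type;
  cat_id : forall x, cat_hom x x;
  cat_comp : forall x y z, cat_hom y z -> cat_hom x y -> cat_hom x z;
  cat_comp_idl : forall x y (f : cat_hom x y), cat_comp (cat_id y) f = f;
  cat_comp_idr : forall x y (f : cat_hom x y), cat_comp f (cat_id x) = f;
  cat_compA : forall x y z t (f : cat_hom z t) (g : cat_hom y z) (h : cat_hom x y),
    cat_comp f (cat_comp g h) = cat_comp (cat_comp f g) h
}.

(* A functor with prescribed action [F] on objects. *)
Record functor_on (C D : category) (F : C -> D) := FunctorOn {
  fmap : forall x y : C, cat_hom x y -> cat_hom (F x) (F y);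
  fmap_id : forall x : C, fmap (cat_id x) = cat_id (F x);
  fmap_comp : forall (x y z : C) (f : cat_hom y z) (g : cat_hom x y),
    fmap (cat_comp f g) = cat_comp (fmap f) (fmap g)
}.

Inductive mor_kind := Isometric | Adjointable | Unitary.

Definition mor_cond (k : mor_kind) (R : orderedRingType)
    (V W : hermSpaceType R) (U : V -> W) : Prop :=
  match k with
  | Isometric => forall u v : V, ip (U u) (U v) = ip u v
  | Adjointable => exists S : W -> V, is_adjoint U S
  | Unitary => exists S : W -> V, [/\ is_adjoint U S, cancel U S & cancel S U]
  end.

Lemma mor_cond_comp (k : mor_kind) (R : orderedRingType)
    (V W Z : hermSpaceType R) (S : W -> Z) (T : V -> W) :
  mor_cond k S -> mor_cond k T -> mor_cond k (S \o T).
Proof.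
case: k => /= [hS hT u v|[S' adjS] [T' adjT]|].
- by rewrite hS hT.
- by exists (T' \o S') => w v /=; rewrite adjS adjT.
case=> S' [adjS SK S'K] [T' [adjT TK T'K]]; exists (T' \o S'); split.
- by move=> w v /=; rewrite adjS adjT.
- exact: can_comp.
- exact: can_comp.
Qed.

Section RepCategory.
Variables (R : orderedRingType) (A : starAlgType R) (k : mor_kind).

Record intertwiner (H1 H2 : starRep A) := Intertwiner {
  itw_fun :> H1 -> H2;
  itw_linear : linear itw_fun;
  itw_comm : forall (a : A) (u : H1),
    itw_fun (rep_act H1 a u) = rep_act H2 a (itw_fun u);
  itw_cond : mor_cond k itw_fun
}.

Lemma itw_eqP (H1 H2 : starRep A) (S T : intertwiner H1 H2) :
  (S : H1 -> H2) =1 T -> S = T.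
Proof.
case: S T => [S l c e] [T l' c' e'] /= /funext eST.
by case: T / eST l' c' e' => l' c' e'; congr Intertwiner;
  apply: Prop_irrelevance.
Qed.

Fact itw_id_cond (H : starRep A) : mor_cond k (@id H).
Proof. by case: k => //=; exists id. Qed.

Definition itw_id (H : starRep A) : intertwiner H H :=
  @Intertwiner H H id (fun _ _ _ => erefl) (fun _ _ => erefl) (itw_id_cond H).

Section Comp.
Variables (H1 H2 H3 : starRep A).
Variables (S : intertwiner H2 H3) (T : intertwiner H1 H2).

Fact itw_comp_linear : linear ((S : H2 -> H3) \o T).
Proof. by move=> c u v /=; rewrite !itw_linear. Qed.

Fact itw_comp_comm (a : A) (u : H1) :
  ((S : H2 -> H3) \o T) (rep_act H1 a u) =
    rep_act H3 a (((S : H2 -> H3) \o T) u).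
Proof. by rewrite /= !itw_comm. Qed.

Fact itw_comp_cond : mor_cond k ((S : H2 -> H3) \o T).
Proof. exact: mor_cond_comp (itw_cond S) (itw_cond T). Qed.

Definition itw_comp : intertwiner H1 H3 :=
  Intertwiner itw_comp_linear itw_comp_comm itw_comp_cond.

End Comp.

Fact itw_comp_idl (H1 H2 : starRep A) (T : intertwiner H1 H2) :
  itw_comp (itw_id H2) T = T.
Proof. exact: itw_eqP. Qed.

Fact itw_comp_idr (H1 H2 : starRep A) (T : intertwiner H1 H2) :
  itw_comp T (itw_id H1) = T.
Proof. exact: itw_eqP. Qed.

Fact itw_compA (H1 H2 H3 H4 : starRep A) (S : intertwiner H3 H4)
    (T : intertwiner H2 H3) (U : intertwiner H1 H2) :
  itw_comp S (itw_comp T U) = itw_comp (itw_comp S T) U.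
Proof. exact: itw_eqP. Qed.

Definition rep_cat : category :=
  Category itw_comp_idl itw_comp_idr itw_compA.

End RepCategory.

(* Main.v *)
(* The maps x (x) psi |-> [B.x (x) psi] and x (x) psi |-> [x (x) U psi] are
   bilinear and A-balanced, so they extend to X (x)_A H.  An extension T
   descends to the quotient by the radical as soon as T has an adjoint on its
   range, i.e. every functional <T u, T -> is of the form <v, ->: it is
   [B^* B.x (x) psi] for B, and [x (x) psi] or [x (x) U^* U psi] for an
   isometric or adjointable U.  Nondegeneracy of the quotient is the Cauchy-Schwarz fact
   that null vectors of a semidefinite form lie in its radical. *)
Require Import Defs.
From mathcomp Require Import all_boot all_order all_algebra.
From HB Require Import structures.
From mathcomp.classical Require Import boolp.
From mathcomp.real_closed Require Import complex.
From mathcomp.multinomials Require Import freeg.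
From mathcomp Require Import ring.

Set Implicit Arguments.
Unset Strict Implicit.
Unset Printing Implicit Defensive.

Import GRing.Theory.

Local Open Scope ring_scope.

(** * Squares in an ordered ring *)

Section OrderedRingTheory.
Variable R : orderedRingType.
Implicit Types x y : R.

Lemma rpos_sqr x : x = 0 \/ rpos (x * x).
Proof.
case: (rpos_total x) => [xn|->|xp]; [right|by left|right; exact: rposM].
by rewrite -mulrNN; apply: rposM.
Qed.

Lemma rpos1 : rpos (1 : R).
Proof.
by case: (rpos_sqr 1) => [/eqP|]; rewrite ?oner_eq0 // mulr1.
Qed.

(** Nonzero squares are positive, and so are their sums, whereas [0] is not. Applied to the real and
    imaginary parts, this says that a complex number with vanishing square modulus is zero. *)
Lemma sum_sqr_eq0 x y : x * x + y * y = 0 -> x = 0 /\ y = 0.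
Proof.
case: (rpos_sqr x) => [->|xp]; case: (rpos_sqr y) => [->|yp] // /esym;
  rewrite ?(mulr0, addr0, add0r) => e; case: (@rpos0 R); rewrite e //.
exact: rposD.
Qed.

End OrderedRingTheory.

(** * Null vectors of a semidefinite form *)

Section Semidefinite.
Variables (R : orderedRingType) (V : hermSpaceType R).
Hypothesis V_ge0 : pos_semidef V.

(* With [z = <v, u>], [n = |z|^2] and [s = <v, v>], the vector
   [- (s + 1) z^* u + n v] has square norm [- (s + 2) n^2]; no division is
   needed. *)
Lemma null_orth (u v : V) : ip u u = 0 -> ip v u = 0.
Proof.
move=> uu0; have := V_ge0 v; have /= := ip_conj u v.
case vu: (ip v u) => [p q] uv; case vv: (ip v v) => [s i] [/= i0 s_ge0].
set n : R := p * p + q * q.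
have := V_ge0 ((Complex (- (s + 1) * p) ((s + 1) * q) : cplx R) *: u
               + (Complex n 0 : cplx R) *: v).
rewrite !(ipDl, ipDr, ipZl, ipZr) uu0 vv vu uv i0 => -[_].
set t := (X in Re X = 0).
have -> : Re t = - ((s + 1 + 1) * (n * n)) by rewrite /t /n /=; ring.
have s2 : rpos (s + 1 + 1).
  apply: rposD; last exact: rpos1.
  case: s_ge0 => [->|sp]; last by apply: rposD => //; exact: rpos1.
  by rewrite add0r; exact: rpos1.
case: (rpos_sqr n) => [|np].
  by move=> /sum_sqr_eq0[-> ->] _.
have npos := rposM _ _ s2 np.
case=> [/eqP|nneg]; last by case: (rpos_anti _ npos nneg).
rewrite oppr_eq0 => /eqP e.
by case: (@rpos0 R); rewrite -e.
Qed.

End Semidefinite.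

(** * Adjoints of morphisms *)

Section Adjoints.
Variable R : orderedRingType.

(** The property shared by the three kinds of morphism, in the form from which [rieffel_map_exists]
    builds the induced map. For an isometry [v] is [u] itself. *)
Lemma mor_cond_weak_adjoint (k : mor_kind) (V W : hermSpaceType R)
    (U : V -> W) :
  mor_cond k U -> forall u, exists v : V, forall w, ip (U u) (U w) = ip v w.
Proof.
case: k => [U_iso u|[S adjS] u|[S [adjS _ _]] u]; first by exists u.
- by exists (S (U u)).
- by exists (S (U u)).
Qed.

Lemma adjoint_sym (V W : hermSpaceType R) (U : V -> W) (S : W -> V) :
  is_adjoint U S -> is_adjoint S U.
Proof. by move=> adjS w v; rewrite ip_conj -adjS -ip_conj. Qed.

(** [mor_cond] provides the adjoint as a bare function. Since [V] is nondegenerate, the values of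
    [S] are determined by their pairings, which are linear; hence [S] can be induced in its turn. *)
Lemma adjoint_linear (V : preHilbert R) (W : hermSpaceType R) (U : V -> W)
  (S : W -> V) : is_adjoint U S -> linear S.
Proof.
move=> /adjoint_sym adjS c u v; apply: ph_inj => w.
by rewrite ipDr ipZr !adjS ipDr ipZr.
Qed.

(** Take adjoints in the intertwining relation of [U] for [astar a]: the representations respect
    stars, and nondegeneracy of [H1] turns equal pairings into equal vectors. *)
Lemma adjoint_comm (A : starAlgType R) (H1 H2 : starRep A) (U : H1 -> H2)
    (S : H2 -> H1) :
    is_adjoint U S -> (forall a u, U (rep_act H1 a u) = rep_act H2 a (U u)) ->
  forall a u, S (rep_act H2 a u) = rep_act H1 a (S u).
Proof.
move=> adjS commU a u; apply: ph_inj => w.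
rewrite ip_conj -adjS [RHS]ip_conj; congr cconj.
rewrite -[a]astarK !star_hom_star -!adjop_starP -!star_hom_star.
by rewrite -commU adjS.
Qed.

End Adjoints.

(** * Universal properties of quotients, free modules and tensor products *)

Section Lifting.
Variable R : nzRingType.

Lemma linear_morphD (V W : lmodType R) (f : V -> W) :
  linear f -> {morph f : u v / u + v}.
Proof. by move=> linf u v; rewrite -[u in LHS]scale1r linf scale1r. Qed.

Lemma linear_at0 (V W : lmodType R) (f : V -> W) : linear f -> f 0 = 0.
Proof. by move/(_ (-1) 0 0); rewrite scaler0 addr0 scaleN1r addNr. Qed.

Lemma quotmod_lift (V W : lmodType R) (S : submodClosed V)
    (f : {linear V -> W}) : (forall v, v \in S -> f v = 0) ->
  exists g : {linear quotmod S -> W}, forall v, g (qclass S v) = f v.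
Proof.
move=> fS; pose g (x : quotmod S) := f (qrepr x).
have gE v : g (qclass S v) = f v.
  apply/eqP; rewrite -subr_eq0 -linearB; apply/eqP/fS/qclass_eq.
  exact: qreprK.
have g_lin : linear g.
  by move=> c x y; rewrite -[x]qreprK -[y]qreprK -qclass_linear !gE linearP.
by exists (HB.pack_for {linear quotmod S -> W} g
  (GRing.isLinear.Build _ _ _ _ g g_lin)).
Qed.

Lemma linear_lspan_eq0 (V W : lmodType R) (S : V -> Prop)
    (f : {linear V -> W}) : (forall s, S s -> f s = 0) ->
  forall v, v \in lspan S -> f v = 0.
Proof.
move=> fS v /lspanP; elim=> [|c s w Ss _ IHw]; first exact: linear0.
by rewrite linearP fS// IHw scaler0 addr0.
Qed.

Lemma fglift_linear (K : choiceType) (W : lmodType R) (f : K -> W) :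
  linear (fglift f : {freeg K / R} -> W).
Proof.
have fB := lift_is_additive f.
have f0 : fglift f 0 = 0 by have := fB 0 0; rewrite !subrr.
(* [fB] speaks of differences, so [u + v] is read as [u - (0 - v)]. *)
have fD : {morph fglift f : u v / u + v}.
  move=> u v; have := fB u (0 - v); rewrite [fglift f (0 - v)]fB f0.
  by rewrite !sub0r !opprK.
move=> c u v; rewrite fD; congr (_ + _); rewrite -[u in RHS]freeg_sumE.
rewrite !(big_morph _ fD f0) scaler_sumr; apply: eq_bigr => x _.
by rewrite !liftU scalerA.
Qed.

(** The linear extension of [g] to the free module on pairs kills each of the four bilinearity
    relations, hence their span. *)
Lemma tensor_lift (V W U : lmodType R) (g : V -> W -> U) :
    (forall w, linear (g^~ w)) -> (forall v, linear (g v)) ->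
  exists T : {linear tensor V W -> U}, forall v w, T (tens v w) = g v w.
Proof.
move=> gl gr; pose G := fglift (fun p : V * W => g p.1 p.2).
pose f := HB.pack_for {linear {freeg (V * W)%type / R} -> U} G
  (GRing.isLinear.Build _ _ _ _ G (fglift_linear _)).
have fE p : f << p >> = g p.1 p.2 by rewrite [LHS]liftU scale1r.
have fker : forall s, bilinear_rel s -> f s = 0.
  move=> _ [v v' w|v w w'|c v w|c v w]; rewrite !linearB ?linearZ !fE /=.
  - by have := gl w 1 v v'; rewrite !scale1r => ->; rewrite addrAC addrK subrr.
  - by have := gr v 1 w w'; rewrite !scale1r => ->; rewrite addrAC addrK subrr.
  - by rewrite scalerN (GRing.scalable_linear (gl w)) /= subrr.
  by rewrite scalerN (GRing.scalable_linear (gr v)) /= subrr.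
have [T TE] := quotmod_lift (linear_lspan_eq0 fker).
by exists T => v w; rewrite TE fE.
Qed.

Lemma tens_linl (V W : lmodType R) (w : W) : linear (@tens R V W ^~ w).
Proof.
move=> c v v'; rewrite /tens -qclass_linear; apply/qclass_eq.
set a := << (c *: v + v', w) >>; set b := << (v, w) >>.
set d := << (v', w) >>; set e : {freeg (V * W)%type / R} := << (c *: v, w) >>.
(* The defect of linearity splits into an additivity relation and a homogeneity relation, with the
   generator [e] inserted between them. *)
have -> : a - (c *: b + d) = (a - e - d) + (e - c *: b).
  by rewrite addrACA subrK -opprD [d + _]addrC.
by apply: rpredD; apply: mem_lspan; [exact: bilinDl|exact: bilinZl].
Qed.

Lemma tens_linr (V W : lmodType R) (v : V) : linear (@tens R V W v).
Proof.
move=> c w w'; rewrite /tens -qclass_linear; apply/qclass_eq.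
set a := << (v, c *: w + w') >>; set b := << (v, w) >>.
set d := << (v, w') >>; set e : {freeg (V * W)%type / R} := << (v, c *: w) >>.
have -> : a - (c *: b + d) = (a - e - d) + (e - c *: b).
  by rewrite addrACA subrK -opprD [d + _]addrC.
by apply: rpredD; apply: mem_lspan; [exact: bilinDr|exact: bilinZr].
Qed.

(** Simple tensors suffice without coefficients, because a scalar is absorbed by the left factor.
    The induction principles for the two further quotients descend from this one. *)
Lemma tensor_ind (V W : lmodType R) (P : tensor V W -> Prop) :
  P 0 -> (forall v w t, P t -> P (tens v w + t)) -> forall t, P t.
Proof.
move=> P0 PD t; rewrite -[t]qreprK; elim/freeg_ind_dom0: (qrepr t).
  suff -> : qclass (lspan (@bilinear_rel R V W)) 0 = 0 by [].
  exact: raddf0.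
move=> c [v w] D _ _ IH.
suff -> : qclass (lspan (@bilinear_rel R V W)) (<< c *g (v, w) >> + D) =
  tens (c *: v) w + qclass (lspan (@bilinear_rel R V W)) D by exact: PD.
have := tens_linl w c v 0.
have t0 : tens 0 w = 0 :> tensor V W.
  by have := tens_linl w (-1) 0 (0 : V); rewrite scaler0 addr0 scaleN1r addNr.
rewrite t0 !addr0 => ->; rewrite qclassD /tens; congr (_ + _).
have := @qscaleE R _ (lspan (@bilinear_rel R V W)) c << (v, w) >>.
rewrite /GRing.scale /= => ->; congr qclass.
by apply/eqP/freeg_eqP => x; rewrite coeffZ !coeffU mul1r.
Qed.

End Lifting.

(** * Generators, inner product and lifting on the induced space *)

Section RieffelSpace.
Variables (R : orderedRingType) (B A : starAlgType R) (X : innerBimodType B A).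

Section OneRep.
Variable H : starRep A.

Lemma rclass_linl (psi : H) : linear (fun x : X => rclass x psi).
Proof. by move=> c x y; rewrite /rclass /btens tens_linl !qclass_linear. Qed.

Lemma rclass_linr (x : X) : linear (fun psi : H => rclass x psi).
Proof. by move=> c u v; rewrite /rclass /btens tens_linr !qclass_linear. Qed.

Lemma rclass_ract (x : X) (a : A) (psi : H) :
  rclass (ract x a) psi = rclass x (rep_act H a psi).
Proof.
rewrite /rclass; congr qclass; apply/qclass_eq/mem_lspan.
exact: balancedA.
Qed.

Lemma ip_rclass (x y : X) (psi phi : H) :
  ip (rclass x psi) (rclass y phi) = ip psi (rep_act H (aip x y) phi).
Proof.
rewrite -ip_btens.
exact: (qformE (@ip_linr R (balanced X H)) (@ip_conj R _) (@orth_ker R _)).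
Qed.

Lemma balanced_ind (P : balanced X H -> Prop) :
  P 0 -> (forall x psi u, P u -> P (btens x psi + u)) -> forall u, P u.
Proof.
move=> P0 PD u; rewrite -[u]qreprK; elim/tensor_ind: (qrepr u).
  suff -> : qclass (lspan (@balanced_rel R B A X H)) 0 = 0 by [].
  exact: raddf0.
by move=> x psi t IH; rewrite qclassD; exact: PD.
Qed.

Lemma rieffel_ind (P : rieffel_space X H -> Prop) :
  P 0 -> (forall x psi u, P u -> P (rclass x psi + u)) -> forall u, P u.
Proof.
move=> P0 PD u; rewrite -[u]qreprK; elim/balanced_ind: (qrepr u).
  suff -> : qclass (@orth R (balanced X H)) 0 = 0 by [].
  exact: raddf0.
by move=> x psi t IH; rewrite qclassD; exact: PD.
Qed.

Lemma rieffel_linear_ext (W : lmodType (cplx R))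
    (S T : rieffel_space X H -> W) : linear S -> linear T ->
  (forall x psi, S (rclass x psi) = T (rclass x psi)) -> S =1 T.
Proof.
move=> linS linT e.
elim/rieffel_ind => [|x psi u IH]; first by rewrite !linear_at0.
by rewrite (linear_morphD linS) (linear_morphD linT) e IH.
Qed.

Lemma rieffel_preHilbert : pos_semidef (balanced X H) ->
  is_preHilbert (rieffel_space X H).
Proof.
move=> H_ge0.
have ipE (u v : balanced X H) :
    ip (qclass (@orth R (balanced X H)) u : rieffel_space X H) (qclass _ v) =
    ip u v.
  exact: (qformE (@ip_linr R (balanced X H)) (@ip_conj R _) (@orth_ker R _)).
split=> u; rewrite -[u]qreprK ipE; first exact: H_ge0.
(* A null class has a null representative, and [null_orth] puts that representative in the
   radical. *)
move=> uu0; rewrite -[RHS](raddf0 (qclass (@orth R (balanced X H)))).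
apply/qclass_eq; rewrite subr0; apply/asboolP => v.
exact: (null_orth H_ge0).
Qed.

Lemma balanced_lift (W : lmodType (cplx R)) (g : X -> H -> W) :
    (forall psi, linear (g^~ psi)) -> (forall x, linear (g x)) ->
    (forall x a psi, g (ract x a) psi = g x (rep_act H a psi)) ->
  exists T : {linear balanced X H -> W},
    forall x psi, T (btens x psi) = g x psi.
Proof.
move=> gl gr ga; have [T TE] := tensor_lift gl gr.
have Tker : forall s, @balanced_rel R B A X H s -> T s = 0.
  by move=> _ [x a psi]; rewrite linearB !TE ga subrr.
have [S SE] := quotmod_lift (linear_lspan_eq0 Tker).
by exists S => x psi; rewrite SE TE.
Qed.

(* An adjoint defined on the range of [g] suffices for [g] to factor through
   the radical: isometric maps have one even when they are not adjointable. *)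
Lemma rieffel_lift (W : hermSpaceType R) (g : X -> H -> W) :
    is_preHilbert W ->
    (forall psi, linear (g^~ psi)) -> (forall x, linear (g x)) ->
    (forall x a psi, g (ract x a) psi = g x (rep_act H a psi)) ->
    (forall x psi, exists v : rieffel_space X H,
      forall y phi, ip (g x psi) (g y phi) = ip v (rclass y phi)) ->
  exists2 T : rieffel_space X H -> W, linear T &
    forall x psi, T (rclass x psi) = g x psi.
Proof.
move=> [_ Wdef] gl gr ga gadj; have [T TE] := balanced_lift gl gr ga.
have Tker u : u \in @orth R (balanced X H) -> T u = 0.
  move=> u_orth; apply: Wdef.
  have u0 : qclass (@orth R (balanced X H)) u = 0.
    by rewrite -[RHS](raddf0 (qclass (@orth R (balanced X H))));
      apply/qclass_eq; rewrite subr0.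
  (* Only the left [u] in the square norm of [T u] is generalized: [T u] is orthogonal to every
     [T w], by induction on [w]. *)
  elim/balanced_ind: {1}u => [|x psi w IH]; first by rewrite linear0 ip0l.
  rewrite linearD ipDl IH addr0 TE; have [v vE] := gadj x psi.
  (* Pairing [g x psi] with [T u] amounts to pairing [v] with the class of [u], which is zero. *)
  suff -> : ip (g x psi) (T u) =
      ip v (qclass (@orth R (balanced X H)) u : rieffel_space X H).
    by rewrite u0 ip0r.
  (* This identity holds for all [u]; membership in the radical is dropped because the generators
     need not lie there. *)
  elim/balanced_ind: u {u_orth u0 IH} => [|y phi u IHu].
    by rewrite linear0 [qclass _ 0](raddf0 (qclass _)) !ip0r.
  by rewrite linearD qclassD !ipDr IHu TE vE.
have [S SE] := quotmod_lift Tker.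
exists S; first exact: linearP.
by move=> x psi; rewrite [LHS]SE TE.
Qed.

End OneRep.

Lemma rieffel_adjoint (H1 H2 : starRep A)
    (T : rieffel_space X H1 -> rieffel_space X H2)
    (S : rieffel_space X H2 -> rieffel_space X H1) : linear T -> linear S ->
    (forall x psi y phi, ip (rclass y phi) (T (rclass x psi)) =
                         ip (S (rclass y phi)) (rclass x psi)) ->
  is_adjoint T S.
Proof.
move=> linT linS e w v.
elim/rieffel_ind: w => [|y phi w IHw]; first by rewrite linear_at0 ?ip0l.
rewrite (linear_morphD linS) !ipDl {}IHw; congr (_ + _).
elim/rieffel_ind: v => [|x psi v IHv]; first by rewrite linear_at0 ?ip0r.
by rewrite (linear_morphD linT) !ipDr {}IHv e.
Qed.

(** * The induced representation of [B] *)

Section Functor.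
Hypothesis X_ge0 : balanced_semidef X.
Variable k : mor_kind.

Definition rieffel_ph (H : starRep A) : preHilbert R :=
  PreHilbert (rieffel_preHilbert (@X_ge0 H)).

Lemma rieffel_left_exists (H : starRep A) (b : B) :
  exists2 T : rieffel_space X H -> rieffel_space X H, linear T &
    forall x psi, T (rclass x psi) = rclass (lact b x) psi.
Proof.
apply: (@rieffel_lift H (rieffel_space X H)
  (fun x psi => rclass (lact b x) psi)).
- exact: phP (rieffel_ph H).
- by move=> psi c x y; rewrite lact_linr rclass_linl.
- by move=> x; exact: rclass_linr.
- by move=> x a psi; rewrite lractA rclass_ract.
move=> x psi; exists (rclass (lact (astar b) (lact b x)) psi) => y phi.
by rewrite !ip_rclass aip_lact.
Qed.

(** The choice is harmless: by [rieffel_linear_ext] a linear map is determined by its values on the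
    generators. *)
Definition rieffel_left (H : starRep A) (b : B) :
  rieffel_space X H -> rieffel_space X H :=
  s2val (cid2 (rieffel_left_exists H b)).

Lemma rieffel_left_linear (H : starRep A) (b : B) : linear (@rieffel_left H b).
Proof. exact: (s2valP (cid2 (rieffel_left_exists H b))). Qed.

Lemma rieffel_leftE (H : starRep A) (b : B) (x : X) (psi : H) :
  rieffel_left b (rclass x psi) = rclass (lact b x) psi.
Proof. exact: (s2valP' (cid2 (rieffel_left_exists H b))). Qed.

(** Serves twice: it makes the action adjointable and, as adjoints are unique, compatible with
    [astar]. *)
Lemma rieffel_left_adj (H : starRep A) (b : B) :
  is_adjoint (@rieffel_left H b) (rieffel_left (astar b)).
Proof.
apply: rieffel_adjoint => [||x psi y phi].
- exact: rieffel_left_linear.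
- exact: rieffel_left_linear.
by rewrite !rieffel_leftE !ip_rclass aip_lact.
Qed.

Fact rieffel_left_adjointable (H : starRep A) (b : B) :
  (rieffel_left b : rieffel_ph H -> rieffel_ph H) \in
    @adjointable R (rieffel_ph H).
Proof.
apply/adjointableP; split; first exact: rieffel_left_linear.
by exists (rieffel_left (astar b)); exact: rieffel_left_adj.
Qed.

Definition rieffel_act (H : starRep A) (b : B) : adjop (rieffel_ph H) :=
  AdjOp (rieffel_left_adjointable H b).

Fact rieffel_act_linear (H : starRep A) : linear (rieffel_act H).
Proof.
move=> c b b'; apply: adjop_eqP; apply: rieffel_linear_ext.
- exact: (@adjop_linear R (rieffel_ph H)).
- exact: (@adjop_linear R (rieffel_ph H)).
move=> x psi.
change (rieffel_left (c *: b + b') (rclass x psi) =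
  c *: rieffel_left b (rclass x psi) + rieffel_left b' (rclass x psi)).
by rewrite !rieffel_leftE lact_linl rclass_linl.
Qed.

Fact rieffel_actM (H : starRep A) : {morph rieffel_act H : b b' / amul b b'}.
Proof.
move=> b b'; apply: adjop_eqP; apply: rieffel_linear_ext.
- exact: (@adjop_linear R (rieffel_ph H)).
- exact: (@adjop_linear R (rieffel_ph H)).
move=> x psi.
change (rieffel_left (amul b b') (rclass x psi) =
  rieffel_left b (rieffel_left b' (rclass x psi))).
by rewrite !rieffel_leftE lactM.
Qed.

Fact rieffel_act_star (H : starRep A) : {morph rieffel_act H : b / astar b}.
Proof.
move=> b; apply: adjop_eqP => u; apply/esym; move: u.
exact: (adjoint_uniq (@adjop_starP R _ (rieffel_act H b)) (rieffel_left_adj b)).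
Qed.

Definition rieffel_star_hom (H : starRep A) :
    star_hom B (adjop (rieffel_ph H)) :=
  StarHom (@rieffel_act_linear H) (@rieffel_actM H) (@rieffel_act_star H).

Definition rieffel_rep (H : starRep A) : starRep B :=
  StarRep (rieffel_star_hom H).

(** * The induced intertwiners and functoriality *)

Lemma rieffel_map_exists (H1 H2 : starRep A) (U : H1 -> H2) : linear U ->
    (forall a u, U (rep_act H1 a u) = rep_act H2 a (U u)) ->
    (forall u, exists v : H1, forall w, ip (U u) (U w) = ip v w) ->
  exists2 T : rieffel_space X H1 -> rieffel_space X H2, linear T &
    forall x psi, T (rclass x psi) = rclass x (U psi).
Proof.
move=> linU commU adjU.
apply: (@rieffel_lift H1 (rieffel_space X H2) (fun x psi => rclass x (U psi))).
- exact: phP (rieffel_ph H2).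
- by move=> psi; exact: rclass_linl.
- by move=> x c u v; rewrite linU rclass_linr.
- by move=> x a psi; rewrite rclass_ract commU.
move=> x psi; have [v vE] := adjU psi.
(* As [U] intertwines, the action of [aip x y] on [U phi] is [U] of its action on [phi], so [vE]
   applies to the pairing with [U psi]. *)
by exists (rclass x v) => y phi; rewrite !ip_rclass -commU vE.
Qed.

(** An isometry is tested on generators. In the other cases the adjoint [S] of [U] is linear and
    intertwines, so it induces a map [T'], which is adjoint to [T]; if [S] inverts [U], then [T']
    inverts [T] on generators and hence everywhere. *)
Lemma rieffel_map_cond (H1 H2 : starRep A) (U : H1 -> H2)
    (T : rieffel_space X H1 -> rieffel_space X H2) :
    (forall a u, U (rep_act H1 a u) = rep_act H2 a (U u)) -> mor_cond k U ->
    linear T -> (forall x psi, T (rclass x psi) = rclass x (U psi)) ->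
  mor_cond k T.
Proof.
move=> commU Uk linT TE.
have adjoint_map (S : H2 -> H1) : is_adjoint U S ->
    exists T' : rieffel_space X H2 -> rieffel_space X H1,
      [/\ is_adjoint T T', linear T' &
          forall x psi, T' (rclass x psi) = rclass x (S psi)].
  move=> adjS; have commS := adjoint_comm adjS commU.
  have [|T' linT' T'E] :=
    rieffel_map_exists (adjoint_linear adjS) commS.
    (* The adjoint of [S] is [U], which supplies the vector representing the pairing with [S u]. *)
    by move=> u; exists (U (S u)) => w; exact: adjoint_sym.
  exists T'; split=> //; apply: rieffel_adjoint => // x psi y phi.
  by rewrite TE T'E !ip_rclass -commU adjS.
case: k Uk => /= [U_iso u v|[S /adjoint_map[T' [adjT' _ _]]]|].
- elim/rieffel_ind: u => [|x psi u IHu]; first by rewrite linear_at0 ?ip0l.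
  rewrite (linear_morphD linT) !ipDl {}IHu; congr (_ + _).
  elim/rieffel_ind: v => [|y phi v IHv]; first by rewrite linear_at0 ?ip0r.
  by rewrite (linear_morphD linT) !ipDr {}IHv !TE !ip_rclass -commU U_iso.
- by exists T'.
case=> S [/adjoint_map[T' [adjT' linT' T'E]] SK KS]; exists T'; split=> //.
- apply: (rieffel_linear_ext (S := T' \o T) (T := id)) => //.
    by move=> c u v /=; rewrite linT linT'.
  by move=> x psi /=; rewrite TE T'E SK.
- apply: (rieffel_linear_ext (S := T \o T') (T := id)) => //.
    by move=> c u v /=; rewrite linT' linT.
  by move=> x psi /=; rewrite T'E TE KS.
Qed.

Lemma rieffel_intertwiner (H1 H2 : starRep A) (U : intertwiner k H1 H2) :
  exists T : intertwiner k (rieffel_rep H1) (rieffel_rep H2),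
    forall x psi, itw_fun T (rclass x psi) = rclass x (U psi).
Proof.
have [T linT TE] := rieffel_map_exists (@itw_linear _ _ _ _ _ U)
  (@itw_comm _ _ _ _ _ U) (mor_cond_weak_adjoint (itw_cond U)).
(* On a generator [b] acts on the factor in [X] and [T] on the factor in [H1], so the two
   commute. *)
have commT (b : B) u : T (rieffel_left b u) = rieffel_left b (T u).
  apply: (rieffel_linear_ext (S := T \o rieffel_left b)
    (T := rieffel_left b \o T)) => [c v w|c v w|x psi] /=.
  - by rewrite rieffel_left_linear linT.
  - by rewrite linT rieffel_left_linear.
  by rewrite rieffel_leftE !TE rieffel_leftE.
have condT := rieffel_map_cond (@itw_comm _ _ _ _ _ U) (itw_cond U) linT TE.
by exists (@Intertwiner R B k (rieffel_rep H1) (rieffel_rep H2) T linT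
  commT condT).
Qed.

(** Any witness will do: the functor laws are checked on generators, where its values are
    prescribed. *)
Definition rieffel_fmap (H1 H2 : starRep A) (U : intertwiner k H1 H2) :
    intertwiner k (rieffel_rep H1) (rieffel_rep H2) :=
  sval (cid (rieffel_intertwiner U)).

Lemma rieffel_fmapE (H1 H2 : starRep A) (U : intertwiner k H1 H2) (x : X)
  (psi : H1) : itw_fun (rieffel_fmap U) (rclass x psi) = rclass x (U psi).
Proof. exact: (svalP (cid (rieffel_intertwiner U))). Qed.

Lemma rieffel_fmap_id (H : starRep A) :
  rieffel_fmap (itw_id k H) = itw_id k (rieffel_rep H).
Proof.
apply: itw_eqP; apply: rieffel_linear_ext;
  [exact: (@itw_linear R B k (rieffel_rep _) (rieffel_rep _))..|].
by move=> x psi; rewrite rieffel_fmapE.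
Qed.

Lemma rieffel_fmap_comp (H1 H2 H3 : starRep A) (S : intertwiner k H2 H3)
    (T : intertwiner k H1 H2) :
  rieffel_fmap (itw_comp S T) = itw_comp (rieffel_fmap S) (rieffel_fmap T).
Proof.
apply: itw_eqP; apply: rieffel_linear_ext;
  [exact: (@itw_linear R B k (rieffel_rep _) (rieffel_rep _))..|].
by move=> x psi; rewrite rieffel_fmapE /= !rieffel_fmapE.
Qed.

Definition rieffel_functor :
    @functor_on (rep_cat A k) (rep_cat B k) rieffel_rep :=
  @FunctorOn (rep_cat A k) (rep_cat B k) rieffel_rep rieffel_fmap
    rieffel_fmap_id rieffel_fmap_comp.

End Functor.

End RieffelSpace.

Theorem theorem3p5 (R : orderedRingType) (A B : starAlgType R)
    (X : innerBimodType B A) (hP : balanced_semidef X) (k : mor_kind) :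
  exists (hK : forall H : starRep A, is_preHilbert (rieffel_space X H))
         (piB : forall H : starRep A, star_hom B (adjop (PreHilbert (hK H))))
         (RX : @functor_on (rep_cat A k) (rep_cat B k)
                 (fun H : starRep A => StarRep (piB H))),
    (forall (H : starRep A) (b : B) (x : X) (psi : H),
        piB H b (rclass x psi) = rclass (lact b x) psi) /\
    (forall (H1 H2 : starRep A) (U : intertwiner k H1 H2) (x : X) (psi : H1),
        itw_fun (fmap RX U) (rclass x psi) = rclass x (U psi)).
Proof.
exists (fun H => rieffel_preHilbert (@hP H)), (rieffel_star_hom hP),
  (rieffel_functor hP k); split.
- by move=> H b x psi; exact: rieffel_leftE.
- by move=> H1 H2 U x psi; exact: rieffel_fmapE.
Qed.
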